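(* Let $0<x_1<x_2<1$ and let $F:[0,1]^2\to\mathbb{R}$ be a continuous function such that $$F(x,y)=\begin{cases}F_1(x,y)&\text{if }x\in(0,x_1),\\ F_2(x,y)&\text{if }x\in(x_1,x_2),\\ F_3(x,y)&\text{if }x\in(x_2,1),\end{cases}$$ where the mixed second derivatives exist on the respective regions and satisfy $\frac{\partial^2F_1(x,y)}{\partial x\partial y}>0$ for $x\in(0,x_1)$, $\frac{\partial^2F_2(x,y)}{\partial x\partial y}<0$ for $x\in(x_1,x_2)$, and $\frac{\partial^2F_3(x,y)}{\partial x\partial y}>0$ for $x\in(x_2,1)$. If $C$ is a copula which maximizes $\int_0^1\int_0^1F(x,y)\,d\tilde C(x,y)$ over all copulas $\tilde C$, then $C$ has the form $$C(x,y)=\begin{cases}\min(x,h_1(y))&\text{if }x\in[0,x_1],\\ \max(x+h_2(y)-x_2,\,h_1(y))&\text{if }x\in[x_1,x_2],\\ \min(x-x_2+h_2(y),\,y)&\text{if }x\in[x_2,1],\end{cases}$$ for all $y\in[0,1]$, where $h_1(y)=C(x_1,y)$ and $h_2(y)=C(x_2,y)$.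
   Context: A (2-)copula is a function $C:[0,1]^2\to[0,1]$ such that for all $x,y\in[0,1]$: $C(x,0)=C(0,y)=0$, $C(x,1)=x$, $C(1,y)=y$; and for all $x_1\le x_2$, $y_1\le y_2$ in $[0,1]$: $C(x_2,y_2)-C(x_2,y_1)-C(x_1,y_2)+C(x_1,y_1)\ge0$. Each copula $C$ induces a unique Borel probability measure $\gamma_C$ on $[0,1]^2$ with both marginals equal to Lebesgue measure, determined by $\gamma_C([a,b]\times[c,d])=C(b,d)-C(b,c)-C(a,d)+C(a,c)$; the integral $\int_0^1\int_0^1F(x,y)\,dC(x,y)$ means $\int_{[0,1]^2}F\,d\gamma_C$. *)

(* Defs.v *)
From HB Require Import structures.
From mathcomp Require Import all_boot all_order all_algebra.
From mathcomp Require Import all_classical all_reals all_analysis.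
Set Implicit Arguments.
Unset Strict Implicit.
Unset Printing Implicit Defensive.
Import Order.TTheory GRing.Theory Num.Theory.
Import numFieldNormedType.Exports.
Local Open Scope classical_set_scope.
Local Open Scope ring_scope.

(* Functions on [0,1]^2 are represented by total functions R -> R -> R, of
   which only the values on [0,1]^2 are ever constrained or used. *)

Definition unit_square (R : realType) :
    set (measurableTypeR R * measurableTypeR R)%type :=
  `[0%R, 1%R] `*` `[0%R, 1%R].

Record is_copula (R : realType) (C : R -> R -> R) : Prop := IsCopula {
  copula_range : forall x y : R, 0 <= x <= 1 -> 0 <= y <= 1 -> 0 <= C x y <= 1;
  copula_x0 : forall x : R, 0 <= x <= 1 -> C x 0 = 0;
  copula_0y : forall y : R, 0 <= y <= 1 -> C 0 y = 0;
  copula_x1 : forall x : R, 0 <= x <= 1 -> C x 1 = x;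
  copula_1y : forall y : R, 0 <= y <= 1 -> C 1 y = y;
  copula_2incr : forall a b c d : R,
    0 <= a -> a <= b -> b <= 1 -> 0 <= c -> c <= d -> d <= 1 ->
    0 <= C b d - C b c - C a d + C a c
}.

(* [gamma] is the Borel probability measure induced by [C].  It is a measure on
   the plane (with the product sigma-algebra, i.e. the Borel one); the instance
   a = c = 0, b = d = 1 says that it is concentrated on the unit square, and
   c = 0, d = 1 (resp. a = 0, b = 1) that its marginals are uniform on [0,1]. *)
Definition induces (R : realType) (C : R -> R -> R)
    (gamma : probability (measurableTypeR R * measurableTypeR R)%type R) : Prop :=
  forall a b c d : R,
    0 <= a -> a <= b -> b <= 1 -> 0 <= c -> c <= d -> d <= 1 ->
    gamma (`[a, b] `*` `[c, d]) = (C b d - C b c - C a d + C a c)%:E.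

(* The measure induced by a copula exists and is unique, so the quantifiers over
   [gammaC] and [gammaD] merely name it; existence is not part of the
   hypothesis. *)
Definition maximizes (R : realType) (F C : R -> R -> R) : Prop :=
  is_copula C /\
  forall D : R -> R -> R, is_copula D ->
  forall gammaC gammaD, induces C gammaC -> induces D gammaD ->
    (\int[gammaD]_(z in @unit_square R) (F z.1 z.2)%:E
      <= \int[gammaC]_(z in @unit_square R) (F z.1 z.2)%:E)%E.

Definition continuous_on_square (R : realType) (F : R -> R -> R) : Prop :=
  {within (@unit_square R : set (R * R)),
    continuous (fun z : R * R => F z.1 z.2)}.

Definition partial_y (R : realType) (F : R -> R -> R) (x y : R) : R :=
  derive1 (fun t : R => F x t) y.

(* d^2 F / dx dy = d/dx (d F / dy) *)
Definition partial_xy (R : realType) (F : R -> R -> R) (x y : R) : R :=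
  derive1 (fun s : R => partial_y F s y) x.

(* [derive1] is total, so existence of the derivatives is stated separately. *)
Definition has_partial_xy (R : realType) (F : R -> R -> R) (a b : R) : Prop :=
  forall x y : R, a < x < b -> 0 < y < 1 ->
    derivable (fun t : R => F x t) y 1 /\
    derivable (fun s : R => partial_y F s y) x 1.

(* Main.v *)
(** If [C] does not have the claimed form at a point [(x, y)] of a strip where
    [F] is strictly 2-increasing, then [gamma_C] charges both a rectangle [A]
    lying up and to the left of [(x, y)] and a rectangle [B] lying down and to
    the right of it.  Draw [z] and [w] independently from [gamma_C] and exchange
    their second coordinates when one is in [A] and the other in [B]: the law of
    the new [z] still has uniform marginals, hence is induced by a copula, and
    it gives [F] a strictly larger integral.  The strip where [F] is strictly
    2-decreasing is symmetric, with [A] below [B].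

    [maximizes] quantifies over the measures induced by [C], so one such measure
    must be constructed.  For each [y], the Stieltjes measure of [C (., y)] is
    dominated by the uniform law, with a density [f y] in [0, 1] that is
    almost everywhere nondecreasing in [y]; with [U] and [V] independent and
    uniform, the pair of [U] and [inf {q rational | V <= f q U}] has
    distribution function [C]. *)
Require Import Defs.
From HB Require Import structures.
From mathcomp Require Import all_boot all_order all_algebra.
From mathcomp Require Import all_classical all_reals all_analysis.
From mathcomp Require Import measurable_realfun lra.
Import Order.TTheory GRing.Theory Num.Theory.
Import numFieldNormedType.Exports.
Local Open Scope classical_set_scope.
Local Open Scope ring_scope.

(** * Strict 2-monotonicity from mixed derivatives *)

(** Strictness comes from two interior points [m1 < m2] placed between [s] and [t]. At an endpoint
    only the weak comparison with [m1] or [m2] is needed, and it survives the one-sided limit. *)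
Lemma lt_homo_itv_closure (R : realType) (f : R -> R) (p q : R) : p < q ->
  {within `[p, q], continuous f} ->
  {in `]p, q[ &, {homo f : x y / x < y}} ->
  {in `[p, q] &, {homo f : x y / x < y}}.
Proof.
move=> pq /(continuous_within_itvP _ pq)[_ fp fq] incf s t.
rewrite !in_itv/= => /andP[ps sq] /andP[pt tq] st.
pose m1 := (2 * s + t) / 3; pose m2 := (s + 2 * t) / 3.
have [sm1 m12 m2t] : [/\ s < m1, m1 < m2 & m2 < t].
  by rewrite /m1 /m2; split; lra.
have mem x : s < x -> x < t -> x \in `]p, q[.
  by move=> sx xt; rewrite in_itv/= (le_lt_trans ps)// (lt_le_trans xt).
have fs1 : f s <= f m1.
  move: ps; rewrite le_eqVlt => /predU1P[ps|ps]; last first.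
    by apply/ltW/incf => //; [rewrite in_itv/=; lra|apply: mem; lra].
  rewrite -ps; apply: (@closed_cvg _ _ p^'+ _ f (fun y => y <= f m1)) => //.
  near=> x; apply/ltW/incf; last by near: x; apply: nbhs_right_lt; lra.
    by apply: mem; [rewrite -ps|apply: (@lt_trans _ _ m1) => //; [near: x; apply: nbhs_right_lt; lra|lra]].
  by apply: mem; lra.
have f2t : f m2 <= f t.
  move: tq; rewrite le_eqVlt => /predU1P[tq|tq]; last first.
    by apply/ltW/incf => //; [apply: mem; lra|rewrite in_itv/=; lra].
  rewrite tq; apply: (@closed_cvg _ _ q^'- _ f (fun y => f m2 <= y)) => //.
  near=> x; apply/ltW/incf; last by near: x; apply: nbhs_left_gt; lra.
    by apply: mem; lra.
  by apply: mem; [apply: (@lt_trans _ _ m2) => //; [lra|near: x; apply: nbhs_left_gt; lra]|rewrite tq].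
apply: (le_lt_trans fs1); apply: lt_le_trans f2t.
by apply: incf => //; apply: mem; lra.
Unshelve. all: by end_near. Qed.

(** Applied below to horizontal and vertical segments, whose sections of [F] are thus continuous up
    to the boundary of the square. *)
Lemma within_continuous_curve (R : realType) (F : R -> R -> R) (g : R -> R * R)
    (p q : R) : continuous_on_square F -> continuous g ->
  (forall t, p <= t <= q -> 0 <= (g t).1 <= 1 /\ 0 <= (g t).2 <= 1) ->
  {within `[p, q], continuous (fun t => F (g t).1 (g t).2)}.
Proof.
move=> /(@subspace_continuousP (R * R)%type) cF cg gS.
apply/subspace_continuousP => t /=; rewrite in_itv/= => /gS[h1 h2] V nV.
have St : unit_square (g t) by split; rewrite /= in_itv.
have : nbhs t (g @^-1` [set z | unit_square z -> V (F z.1 z.2)]).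
  exact: cg t _ (cF _ St _ nV).
suff sub : g @^-1` [set z | unit_square z -> V (F z.1 z.2)] `<=`
    [set s | s \in `[p, q] -> V (F (g s).1 (g s).2)] by exact: filterS sub.
move=> s /= hs; rewrite in_itv/= => /gS[k1 k2].
by apply: hs; split; rewrite /= in_itv.
Qed.

(** Two monotonicity arguments replace a double integral. A positive mixed derivative makes
    [partial_y G] strictly increasing in [x], so for [s < t] in the open strip [F t y - F s y] is
    strictly increasing in [y]. Equivalently [F x d - F x c] is strictly increasing in [x], and
    continuity of [F] carries this to the closed strip. *)
Lemma strictly_2increasing (R : realType) (F G : R -> R -> R) (p q : R) :
  0 <= p -> p < q -> q <= 1 -> continuous_on_square F ->
  (forall x y : R, p < x < q -> 0 <= y <= 1 -> F x y = G x y) ->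
  has_partial_xy G p q ->
  (forall x y : R, p < x < q -> 0 < y < 1 -> 0 < partial_xy G x y) ->
  forall a b c d : R, p <= a -> a < b -> b <= q -> 0 <= c -> c < d -> d <= 1 ->
  F a d + F b c < F a c + F b d.
Proof.
move=> p0 pq q1 cF FG dG posG a b c d pa ab bq c0 cd d1.
have incGy y : 0 < y < 1 ->
    {in `]p, q[ &, {homo (fun s => partial_y G s y) : s t / s < t}}.
  move=> y01; apply: gtr0_derive1_lt_oo.
  - by move=> x; rewrite in_itv/= => xpq; have [] := dG x y xpq y01.
  - by move=> x; rewrite in_itv/= => xpq; exact: posG.
  - move=> x; rewrite inE/= in_itv/= => xpq; apply: differentiable_continuous.
    by apply/derivable1_diffP; have [] := dG x y xpq y01.
have inc_interior : {in `]p, q[ &, {homo (fun x => F x d - F x c) : s t / s < t}}.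
  move=> s t; rewrite !in_itv/= => sI tI st.
  have [tF sF] : (forall y, 0 <= y <= 1 -> F t y = G t y) /\
      (forall y, 0 <= y <= 1 -> F s y = G s y) by split=> y; exact: FG.
  suff : F t c - F s c < F t d - F s d by lra.
  have sub01 (x : R) : x \in `]0, 1[ -> 0 < x < 1 by rewrite in_itv.
  have drv x : 0 < x < 1 -> derivable (fun y => F t y - F s y) x 1 /\
      derive1 (fun y => F t y - F s y) x = partial_y G t x - partial_y G s x.
    move=> x01; have [dt _] := dG t x tI x01; have [ds _] := dG s x sI x01.
    (* [F] and [G] agree only for heights in [0, 1], so derivatives are transferred through equality
       near an interior height. *)
    have e : {near x, (fun y => G t y - G s y) =1 (fun y => F t y - F s y)}.
      have : \forall y \near x, y \in `]0, 1[ by apply: near_in_itvoo; rewrite in_itv.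
      apply: filterS => y; rewrite in_itv/= => /andP[/ltW y0 /ltW y1].
      by rewrite tF ?sF ?y0.
    split; first by apply: (@near_eq_derivable R R R _ _ x 1 e); exact: derivableB.
    rewrite derive1E -(@near_eq_derive R R R _ _ x 1 e)//.
    by rewrite deriveB// /partial_y !derive1E.
  apply: (@gtr0_derive1_lt_cc _ (fun y => F t y - F s y) 0 1) => //.
  - by move=> x /sub01 /drv[].
  - move=> x /sub01 x01; have [_ ->] := drv x x01.
    by rewrite subr_gt0; apply: incGy => //; rewrite in_itv.
  - have cFx x : p < x < q -> {within `[0, 1], continuous (fun y => F x y)}.
      move=> xI; apply: (@within_continuous_curve _ F (fun y => (x, y))) => //.
        by move=> y; apply: (cvg_pair (cvg_cst x) (@cvg_id _ (nbhs y))).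
      by move=> y y01; split => //=; lra.
    by move=> x; apply: cvgB; apply: cFx.
  - by rewrite in_itv/=; lra.
  - by rewrite in_itv/=; lra.
suff : F a d - F a c < F b d - F b c by lra.
apply: (@lt_homo_itv_closure _ (fun x => F x d - F x c) p q) => //.
- have cFy y : 0 <= y <= 1 -> {within `[p, q], continuous (fun x => F x y)}.
    move=> yI; apply: (@within_continuous_curve _ F (fun x => (x, y))) => //.
      by move=> x; apply: (cvg_pair (@cvg_id _ (nbhs x)) (cvg_cst y)).
    by move=> x xpq; split => //=; lra.
  by move=> x; apply: cvgB; apply: cFy; lra.
- by rewrite in_itv/=; lra.
- by rewrite in_itv/=; lra.
Qed.

(** * Copulas and measures with uniform marginals *)

Lemma measure_itv_split (R : realType)
    (m : {measure set (measurableTypeR R) -> \bar R}) (a b : R) :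
  0 <= a -> a <= b -> m `[0, b]%classic = (m `[0%R, a]%classic + m `]a, b]%classic)%E.
Proof.
move=> a0 ab; rewrite -measureU//.
- congr (m _); apply/seteqP; split => x /=; rewrite !in_itv/=.
    by move=> /andP[x0 xb]; case: (leP x a) => xa; [left; lra|right; lra].
  by case=> h; lra.
- by apply/seteqP; split => x //=; rewrite !in_itv/= => -[h k]; lra.
Qed.

(** A point [a > 0] lies in []b, a]] with [b = max(0, a - e)], an interval of mass at most [e]; for
    [a = 0] the point is the interval [0, 0]. *)
Lemma uniform_null (R : realType)
    (m : {measure set (measurableTypeR R) -> \bar R}) (a : R) :
  (forall x, 0 <= x <= 1 -> m `[0, x]%classic = x%:E) -> 0 <= a <= 1 ->
  m [set a] = 0%E.
Proof.
move=> um a01; apply/eqP; rewrite eq_le measure_ge0 andbT.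
have [->|a0] := eqVneq a 0; first by rewrite -set_itv1 um//; lra.
apply/lee_addgt0Pr => e e0; rewrite add0e.
pose b := Num.max 0 (a - e).
have [b0 ba be] : [/\ 0 <= b, b < a & a - e <= b].
  by rewrite /b; case: (lerP 0 (a - e)) => h; split; lra.
have := @measure_itv_split _ m b a b0 (ltW ba); rewrite !um; [|lra|lra].
move=> eqa; have le1 : (m [set a] <= m `]b, a]%classic)%E.
  apply: le_measure; rewrite ?inE//; move=> x ->/=; rewrite in_itv/=; lra.
have fin : m `]b, a]%classic \is a fin_num.
  by case: (m _) eqa (measure_ge0 m `]b, a]%classic).
apply: (le_trans le1); rewrite -(fineK fin) in eqa *.
by move: eqa; rewrite -EFinD => -[eqa]; rewrite lee_fin; lra.
Qed.

Lemma measure_itv_cc (R : realType)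
    (m : {measure set (measurableTypeR R) -> \bar R}) (a b : R) :
  m [set a] = 0%E -> 0 <= a -> a <= b ->
  m `[0, b]%classic = (m `[0%R, a]%classic + m `[a, b]%classic)%E.
Proof.
move=> ma a0 ab; rewrite (@measure_itv_split _ m a b)//; congr (_ + _)%E.
rewrite -[X in _ = m X](@setU1itv _ _ (BRight b) a false) ?bnd_simp//.
rewrite measureU//; first by rewrite [X in (X + _)%E]ma add0e.
by apply/seteqP; split => x //= -[->]; rewrite in_itv/= ltxx.
Qed.

(** With one side of a rectangle fixed, the mass is a measure in the other side, so the interval
    lemmas above apply to rectangles. It is the restriction of [m] to a band, pushed forward along a
    projection. *)
Lemma slice_fst d1 d2 (T1 : measurableType d1) (T2 : measurableType d2)
    (R : realType) (m : {measure set (T1 * T2) -> \bar R}) (J : set T2) :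
  measurable J ->
  exists n : {measure set T1 -> \bar R}, forall U, n U = m (U `*` J).
Proof.
move=> mJ; have mTJ : measurable ([set: T1] `*` J) by exact: measurableX.
exists (pushforward (mrestr m mTJ) fst) => U; rewrite /pushforward /mrestr.
by congr (m _); apply/seteqP; split => x //= [] // ? [].
Unshelve. exact: measurable_fst. Qed.

Lemma slice_snd d1 d2 (T1 : measurableType d1) (T2 : measurableType d2)
    (R : realType) (m : {measure set (T1 * T2) -> \bar R}) (I : set T1) :
  measurable I ->
  exists n : {measure set T2 -> \bar R}, forall V, n V = m (I `*` V).
Proof.
move=> mI; have mIT : measurable (I `*` [set: T2]) by exact: measurableX.
exists (pushforward (mrestr m mIT) snd) => V; rewrite /pushforward /mrestr.
by congr (m _); apply/seteqP; split => x //= [] // ? [].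
Unshelve. exact: measurable_snd. Qed.

(** Uniform marginals make every vertical and horizontal segment of the square null. Closed
    rectangles sharing an edge therefore have additive masses, which gives the rectangle formula for
    [D]; the copula inequality is then nonnegativity of [m]. *)
Lemma copula_of_uniform_marginals (R : realType)
    (m : probability (measurableTypeR R * measurableTypeR R)%type R) :
  (forall x : R, 0 <= x <= 1 -> m (`[0, x] `*` `[0, 1]) = x%:E) ->
  (forall y : R, 0 <= y <= 1 -> m (`[0, 1] `*` `[0, y]) = y%:E) ->
  let D x y := fine (m (`[0, x] `*` `[0, y])) in
  is_copula D /\ induces D m.
Proof.
move=> m1 m2 D.
have mR (a b c d : R) : measurable
    (`[a, b] `*` `[c, d] : set (measurableTypeR R * measurableTypeR R)).
  exact: measurableX.
have mD (x y : R) : m (`[0, x] `*` `[0, y]) = (D x y)%:E.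
  by rewrite fineK// fin_num_measure.
have sub0 (s : R) : 0 <= s -> s <= 1 -> `[0, s]%classic `<=` `[0, 1]%classic.
  by move=> s0 s1 x /=; rewrite !in_itv/=; lra.
have null1 (a : R) (J : set (measurableTypeR R)) : 0 <= a <= 1 ->
    measurable J -> J `<=` `[0, 1]%classic -> m ([set a] `*` J) = 0%E.
  move=> a01 mJ J01; have [n nE'] := @slice_fst _ _ _ _ _ m `[0, 1]%classic (measurable_itv _).
  have nE U : n U = m (U `*` `[0, 1]) := nE' U.
  have : n [set a] = 0%E.
    by apply: uniform_null => // x x01; rewrite nE m1.
  rewrite nE => na; apply/eqP; rewrite eq_le measure_ge0 andbT -na.
  apply: le_measure; rewrite ?inE//; [exact: measurableX|exact: measurableX|].
  by move=> x [? ?]; split => //; exact: J01.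
have null2 (c : R) (I : set (measurableTypeR R)) : 0 <= c <= 1 ->
    measurable I -> I `<=` `[0, 1]%classic -> m (I `*` [set c]) = 0%E.
  move=> c01 mI I01; have [n nE'] := @slice_snd _ _ _ _ _ m `[0, 1]%classic (measurable_itv _).
  have nE U : n U = m (`[0, 1] `*` U) := nE' U.
  have : n [set c] = 0%E.
    by apply: uniform_null => // x x01; rewrite nE m2.
  rewrite nE => na; apply/eqP; rewrite eq_le measure_ge0 andbT -na.
  apply: le_measure; rewrite ?inE//; [exact: measurableX|exact: measurableX|].
  by move=> x [? ?]; split => //; exact: I01.
have rect (a b c d : R) : 0 <= a -> a <= b -> b <= 1 ->
    0 <= c -> c <= d -> d <= 1 ->
    m (`[a, b] `*` `[c, d]) = (D b d - D b c - D a d + D a c)%:E.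
  move=> a0 ab b1 c0 cd d1.
  have step (s : R) : 0 <= s -> s <= 1 ->
      m (`[a, b] `*` `[0, s]) = (D b s - D a s)%:E.
    move=> s0 s1; have [n nE'] := @slice_fst _ _ _ _ _ m `[0, s]%classic (measurable_itv _).
  have nE U : n U = m (U `*` `[0, s]) := nE' U.
    have na : n [set a] = 0%E by rewrite nE null1//; [lra|exact: sub0].
    have := measure_itv_cc _ _ _ _ na a0 ab; rewrite !nE !mD.
    have : m (`[a, b] `*` `[0, s]) \is a fin_num by rewrite fin_num_measure.
    by move=> /fineK <-; rewrite -EFinD => -[] h; congr (_%:E); lra.
  have [n nE'] := @slice_snd _ _ _ _ _ m `[a, b]%classic (measurable_itv _).
  have nE U : n U = m (`[a, b] `*` U) := nE' U.
  have nc : n [set c] = 0%E.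
    by rewrite nE null2//; [lra|move=> x /=; rewrite !in_itv/=; lra].
  have := measure_itv_cc _ _ _ _ nc c0 cd; rewrite !nE !step; [|lra..].
  have : m (`[a, b] `*` `[c, d]) \is a fin_num by rewrite fin_num_measure.
  by move=> /fineK <-; rewrite -EFinD => -[] h; congr (_%:E); lra.
split; last exact: rect.
have D0 x y : 0 <= D x y by rewrite fine_ge0.
split => //.
- move=> x y x01 y01; rewrite D0 -lee_fin -mD/=.
  by apply: (le_trans (probability_le1 _ _)).
- move=> x x01; rewrite /D set_itv1 null2//; [lra|by apply: sub0; lra].
- move=> y y01; rewrite /D set_itv1 null1//; [lra|by apply: sub0; lra].
- by move=> x x01; rewrite /D m1.
- by move=> y y01; rewrite /D m2.
- by move=> a b c d *; rewrite -lee_fin -rect.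
Qed.

(** * Integration of [F] over the square *)

(** An open set is the union of the open boxes with rational corners that it contains, and there are
    countably many of them. *)
Lemma open_measurable_plane (R : realType) (O : set (R * R)) : open O ->
  measurable (O : set (measurableTypeR R * measurableTypeR R)).
Proof.
move=> oO.
pose box (a b c d : rat) : set (measurableTypeR R * measurableTypeR R) :=
  `]ratr a, ratr b[ `*` `]ratr c, ratr d[.
rewrite (_ : O = \bigcup_a \bigcup_b \bigcup_c \bigcup_d
    (if `[< box a b c d `<=` O >] then box a b c d else set0)); last first.
  apply/seteqP; split => z; last first.
    by case=> a _ [b _ [c _ [d _]]]; case: asboolP => // /[apply].
  rewrite openE in oO; move=> /oO[[P1 P2]] /= [nP1 nP2] PO.
  have [e1 /= e10 e1P] := nP1; have [e2 /= e20 e2P] := nP2.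
  have ex (x e : R) : 0 < e -> exists a b : rat,
      (x \in `]ratr a, ratr b[) /\ forall y, y \in `]ratr a, ratr b[ -> `|x - y| < e.
    move=> e0.
    have /rat_in_itvoo[a] : x - e < x by rewrite ltrBlDr ltrDl.
    rewrite in_itv/= => /andP[xa ax].
    have /rat_in_itvoo[b] : x < x + e by rewrite ltrDl.
    rewrite in_itv/= => /andP[xb bx].
    exists a, b; rewrite in_itv/= ax xb; split => // y; rewrite in_itv/= => /andP[ay yb].
    by rewrite ltr_norml; lra.
  have [a [b [ab1 ab2]]] := ex z.1 e1 e10.
  have [c [d [cd1 cd2]]] := ex z.2 e2 e20.
  exists a => //; exists b => //; exists c => //; exists d => //.
  have -> : `[< box a b c d `<=` O >] = true.
    apply/asboolP => -[u v] [/= uab vcd]; apply: PO.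
    by split; [apply: e1P; exact: ab2|apply: e2P; exact: cd2].
  by split.
do 4 (apply: bigcupT_measurable_rat => ?).
by case: asboolP => // _; apply: measurableX.
Qed.

Lemma measurable_unit_square (R : realType) : measurable (@unit_square R).
Proof. exact: measurableX. Qed.

Lemma measurable_on_square (R : realType) (F : R -> R -> R) :
  continuous_on_square F ->
  measurable_fun (@unit_square R) (fun z => F z.1 z.2).
Proof.
move=> /(@continuousP (subspace (@unit_square R : set (R * R)%type))) cF.
apply: (measurability _ (RGenOpens.measurableE R)).
move=> _ [_ [a [b ->] <-]].
have /open_subspaceP[V oV VD] := cF _ (@interval_open R (BSide false a) (BSide true b) isT isT).
rewrite setIC -[X in measurable X]VD.
apply: measurableI; last exact: measurable_unit_square.
exact: open_measurable_plane.
Qed.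

Lemma bounded_on_square (R : realType) (F : R -> R -> R) :
  continuous_on_square F -> exists M : R,
  forall z, unit_square z -> `|F z.1 z.2| <= M.
Proof.
move=> cF.
have /compact_bounded[M [_ /(_ (M + 1))]] :=
  continuous_compact cF (compact_setX (@segment_compact R 0 1) (@segment_compact R 0 1)).
rewrite ltrDl ltr01 => /(_ isT) FM; exists (M + 1) => z zS.
by apply: FM; exists z.
Qed.

(** A nonnegative function of zero integral vanishes outside a null set, which would have to contain
    [D]. *)
Lemma integral_gt0_on d (T : measurableType d) (R : realType)
    (mu : {measure set T -> \bar R}) (k : T -> R) (D : set T) :
  measurable D -> (0 < mu D)%E -> mu.-integrable setT (EFin \o k) ->
  (forall x, 0 <= k x) -> (forall x, D x -> 0 < k x) ->
  (0 < \int[mu]_x (k x)%:E)%E.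
Proof.
move=> mD D0 ik k0 kD; rewrite lt_neqAle integral_ge0 ?andbT; last first.
  by move=> x _; rewrite lee_fin.
apply/eqP => /esym ik0.
have mk := measurable_int _ ik.
have /(ae_eq_integral_abs mu measurableT mk)[N [mN N0 sub]] :
    (\int[mu]_(x in setT) `|(EFin \o k) x|)%E = 0%R.
  by rewrite -[RHS]ik0; apply: eq_integral => x _ /=; rewrite ger0_norm.
have : (mu D <= mu N)%E.
  apply: le_measure; rewrite ?inE// => x Dx; apply: sub => /= /(_ I)[] kx.
  by have := kD x Dx; rewrite kx ltxx.
by rewrite N0 leNgt D0.
Qed.

(** The image of the product measure under the swap agrees with it on measurable rectangles, which
    determine it. *)
Lemma product_measure_swap d (T : measurableType d) (R : realType)
    (P : probability T R) (E : set (T * T)) : measurable E ->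
  (P \x P)%E ((fun w => (w.2, w.1)) @^-1` E) = (P \x P)%E E.
Proof.
move=> mE.
have msw : measurable_fun [set: T * T] (fun w : T * T => (w.2, w.1)).
  by apply: measurable_fun_pair; [exact: measurable_snd|exact: measurable_fst].
pose m' : {measure set (T * T) -> \bar R} :=
  distribution (P \x P)%E (mfun_Sub (mem_set msw)).
apply/esym/(@product_measure_unique _ _ T T R P P m') => // A B mA mB.
rewrite /m' /= /distribution /pushforward.
rewrite (_ : _ @^-1` _ = B `*` A); first by rewrite product_measure1E// muleC.
by apply/seteqP; split => x /= [].
Qed.

(** * Exchanging second coordinates *)

(* [P'] is the law of [phi (z, w)] for [z], [w] independent of law [P]; its second
   marginal is that of [P] because [P \x P] is invariant under swapping [z] and [w]. *)
Lemma exchange_second d1 d2 (T1 : measurableType d1) (T2 : measurableType d2)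
    (R : realType) (P : probability (T1 * T2)%type R) (f : T1 * T2 -> R)
    (M : R) (A B : set (T1 * T2)) :
  measurable_fun setT f -> (forall z, `|f z| <= M) ->
  measurable A -> measurable B -> (0 < P A)%E -> (0 < P B)%E ->
  (forall z w, A z -> B w -> f z + f w < f (z.1, w.2) + f (w.1, z.2)) ->
  exists P' : probability (T1 * T2)%type R,
  [/\ forall U, measurable U -> P' (U `*` setT) = P (U `*` setT),
      forall V, measurable V -> P' (setT `*` V) = P (setT `*` V)
    & (\int[P]_z (f z)%:E < \int[P']_z (f z)%:E)%E].
Proof.
move=> mf fM mA mB A0 B0 fAB.
pose T := (T1 * T2)%type.
pose S : set (T * T) := A `*` B `|` B `*` A.
have mS : measurable S by apply: measurableU; exact: measurableX.
pose Q : probability (T * T)%type R := (P \x P)%E.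
pose sw (w : T * T) : T * T := (w.2, w.1).
have msw : measurable_fun setT sw.
  by apply: measurable_fun_pair; [exact: measurable_snd|exact: measurable_fst].
have QsW E : measurable E -> Q (sw @^-1` E) = Q E by exact: product_measure_swap.
have Ssw : sw @^-1` S = S.
  by apply/seteqP; split => -[z w] /= [[? ?]|[? ?]]; [right|left|right|left].
(* [S] is symmetric, so a pair and its swap are exchanged together or not at all. The first
   coordinate is never touched, whence the first marginal. *)
pose phi (w : T * T) : T := (w.1.1, if w \in S then w.2.2 else w.1.2).
have mphi : measurable_fun setT phi.
  apply: measurable_fun_pair.
    exact: (measurableT_comp measurable_fst measurable_fst).
  apply: measurable_fun_ifT.
  - apply: (measurable_fun_bool true); rewrite setTI.
    by rewrite (_ : _ @^-1` _ = S)//; apply/seteqP; split => w /=; [exact: set_mem|exact: mem_set].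
  - exact: (measurableT_comp measurable_snd measurable_snd).
  - exact: (measurableT_comp measurable_snd measurable_fst).
pose P' : probability T R := distribution Q (mfun_Sub (mem_set mphi)).
have P'E E : P' E = Q (phi @^-1` E) by [].
have QX E E' : measurable E -> measurable E' -> Q (E `*` E') = (P E * P E')%E.
  by move=> mE mE'; exact: product_measure1E.
have QfstE E : measurable E -> Q (E `*` setT) = P E.
  by move=> mE; rewrite QX// probability_setT mule1.
have QU E1 E2 : measurable E1 -> measurable E2 -> E1 `&` E2 = set0 ->
    Q (E1 `|` E2) = (Q E1 + Q E2)%E by exact: measureU.
exists P'; split.
- move=> U mU; rewrite P'E -QfstE; last exact: measurableX.
  by congr (Q _); apply/seteqP; split => w /= [] //= [].
- move=> V mV; rewrite P'E -QfstE; last exact: measurableX.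
  set W := (X in _ = Q X).
  have mW : measurable W by do 2 apply: measurableX => //.
  (* On [S] the new second coordinate is that of the swapped pair; off [S] it is the original one.
     Swapping the first piece back keeps its mass and reassembles [W]. *)
  have -> : phi @^-1` (setT `*` V) = (sw @^-1` (S `&` W)) `|` (W `\` S).
    rewrite preimage_setI Ssw; apply/seteqP; split => w; rewrite /phi /W /sw /=.
      by case: ifPn => [|/negP]; rewrite in_setE => Sw [_ ?]; [left|right].
    case=> [[Sw [[_ ?] _]]|[[[_ ?] _] Sw]]; first by rewrite mem_set.
    by rewrite memNset.
  rewrite QU; last 3 first.
  + by rewrite -[X in measurable X]setTI; apply: msw => //; exact: measurableI.
  + exact: measurableD.
  + by rewrite preimage_setI Ssw; apply/seteqP; split => w // [[? _] []].
  rewrite QsW; last exact: measurableI.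
  rewrite -QU; last 3 first.
  + exact: measurableI.
  + exact: measurableD.
  + by apply/seteqP; split => w // [[? _] []].
  congr (Q _); apply/seteqP; split => w; first by case=> -[].
  by move=> Ww; have [Sw|Sw] := pselect (S w); [left|right].
have bint (Y : T * T -> T) : measurable_fun setT Y ->
    Q.-integrable setT (EFin \o (f \o Y)).
  move=> mY; apply: measurable_bounded_integrable => //.
  - by apply: (@le_lt_trans _ _ 1%E); [exact: probability_le1|exact: ltry].
  - exact: measurableT_comp.
  - by exists M; split; rewrite ?num_real// => x Mx w _; exact: (le_trans (fM (Y w)) (ltW Mx)).
have intfst : (\int[P]_z (f z)%:E = \int[Q]_w (f w.1)%:E)%E.
  have <- := @integral_pushforward _ _ _ _ R _ measurable_fst Q setT (EFin \o f).
  - apply: eq_measure_integral => E mE _; transitivity (Q (E `*` setT)).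
      exact/esym/QfstE.
    by congr (Q _); apply/seteqP; split => w //= [].
  - exact: measurableT_comp.
  - by rewrite preimage_setT; exact: (bint fst).
  - exact: measurableT.
have intphi : (\int[P']_z (f z)%:E = \int[Q]_w (f (phi w))%:E)%E.
  have <- := @integral_pushforward _ _ _ _ R _ mphi Q setT (EFin \o f).
  - by apply: eq_measure_integral.
  - exact: measurableT_comp.
  - by rewrite preimage_setT; exact: (bint phi).
  - exact: measurableT.
rewrite intfst intphi.
pose h w := f (phi w) - f w.1.
have ih : Q.-integrable setT (EFin \o h).
  exact: (integrableB measurableT (bint phi mphi) (bint fst measurable_fst)).
have ihsw : Q.-integrable setT (EFin \o (h \o sw)).
  exact: (integrableB measurableT (bint (phi \o sw) (measurableT_comp mphi msw))
    (bint snd measurable_snd)).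
have inth : (\int[Q]_w (h w)%:E = \int[Q]_w (h (sw w))%:E)%E.
  have <- := @integral_pushforward _ _ _ _ R _ msw Q setT (EFin \o h).
  - by apply: eq_measure_integral => E mE _; exact/esym/QsW.
  - exact: measurable_int ih.
  - by rewrite preimage_setT.
  - exact: measurableT.
suff hpos : (0 < \int[Q]_w (h w)%:E)%E.
  rewrite -sube_gt0; apply: lt_le_trans hpos _; rewrite le_eqVlt; apply/orP; left.
  apply/eqP.
  exact: (integralB measurableT (bint phi mphi) (bint fst measurable_fst)).
(* The gain [h] alone may change sign. By swap invariance, twice its integral is the integral of
   [h + h \o sw], which is positive on [S] by [fAB] and zero elsewhere. *)
suff : (0 < \int[Q]_w (h w)%:E + \int[Q]_w (h w)%:E)%E.
  rewrite !ltNge; apply: contra => h0; exact: adde_le0.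
rewrite {2}inth -integralD//.
have hS z w : A z -> B w -> 0 < h (z, w) + h (w, z).
  move=> Az Bw; rewrite /h /phi/= !mem_set; [|by right|by left].
  by have := fAB z w Az Bw; lra.
have kS w : S w -> 0 < h w + h (sw w).
  case: w => z w [] [/= ? ?]; first exact: hS.
  by rewrite addrC; exact: hS.
apply: (@integral_gt0_on _ _ R Q (fun w => h w + h (sw w)) S) => //.
- have : (Q (A `*` B) <= Q S)%E.
    by apply: le_measure; rewrite ?inE//; [exact: measurableX|left].
  by apply: lt_le_trans; rewrite QX// mule_gt0.
- exact: (integrableD measurableT ih ihsw).
- move=> w; have [/kS/ltW//|Sw] := pselect (S w).
  have Sw' : ~ S (sw w) by move=> Sw'; apply: Sw; rewrite -Ssw.
  by rewrite /h /phi !memNset// -!surjective_pairing !subrr addr0.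
Qed.

(** * Existence of the induced measure *)

Lemma lipschitz_cumulative (R : realType) (g : R -> R) :
  (forall a b, a <= b -> 0 <= g b - g a <= b - a) ->
  exists f : cumulative R R, forall x, f x = g x.
Proof.
move=> lipg.
have nd : nondecreasing g by move=> a b /lipg; lra.
have rc : right_continuous g.
  apply: right_continuousW => x; apply/(@cvgrPdist_lt _ R^o) => e e0.
  exists e => //= t; rewrite /ball_/= !ltr_norml => /andP[? ?].
  have [xt|/ltW tx] := leP x t.
    by have /andP[? ?] := lipg _ _ xt; apply/andP; split; lra.
  by have /andP[? ?] := lipg _ _ tx; apply/andP; split; lra.
pose F : cumulative R R := HB.pack g (isCumulative.Build R _ R g nd rc).
by exists F.
Qed.

Lemma stieltjes_itv (R : realType) (f : cumulative R R) (a b : R) : a <= b ->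
  lebesgue_stieltjes_measure f `]a, b]%classic = (f b - f a)%:E.
Proof.
move=> ab; rewrite /lebesgue_stieltjes_measure /measure_extension.
by rewrite measurable_mu_extE/=; [rewrite wlength_itv_bnd|exact: is_ocitv].
Qed.

(** The difference [h - f] is itself a cumulative function. Adding its Stieltjes measure to that of
    [f] gives that of [h], by uniqueness on half-open intervals. *)
Lemma stieltjes_le (R : realType) (f h : cumulative R R) :
  (forall a b, a <= b -> f b - f a <= h b - h a) ->
  forall A : set (measurableTypeR R), measurable A ->
  (lebesgue_stieltjes_measure f A <= lebesgue_stieltjes_measure h A)%E.
Proof.
move=> fh A mA.
pose k x := h x - f x.
have nd : nondecreasing k by move=> a b /fh; rewrite /k; lra.
have rc : right_continuous k.
  by move=> x; apply: (@cvgB _ R^o); exact: cumulative_is_right_continuous.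
pose K : cumulative R R := HB.pack k (isCumulative.Build R _ R k nd rc).
have KE x : K x = h x - f x by [].
have addE X : measure_add (lebesgue_stieltjes_measure f)
    (lebesgue_stieltjes_measure K) X =
    (lebesgue_stieltjes_measure f X + lebesgue_stieltjes_measure K X)%E.
  exact: measure_addE.
have -> : lebesgue_stieltjes_measure h A =
    (lebesgue_stieltjes_measure f A + lebesgue_stieltjes_measure K A)%E.
  rewrite -addE; apply: lebesgue_stieltjes_measure_unique => // X.
  move=> /ocitvP[->|[[a b] /= /ltW ab ->]]; first by rewrite !measure0.
  apply: etrans (esym (addE _)).
  by rewrite !stieltjes_itv// -EFinD !KE; congr (_%:E); lra.
by rewrite leeDl.
Qed.

(** If the set where [g < f] had positive mass, the integral of [f - g] over it would be positive,
    against the hypothesis on that very set. *)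
Lemma density_le d (T : measurableType d) (R : realType)
    (U : {measure set T -> \bar R}) (f g : T -> R) :
  U.-integrable setT (EFin \o f) -> U.-integrable setT (EFin \o g) ->
  (forall A, measurable A ->
    (\int[U]_(x in A) (f x)%:E <= \int[U]_(x in A) (g x)%:E)%E) ->
  U [set x | g x < f x] = 0%E.
Proof.
move=> intf intg fg; pose N := [set x | g x < f x].
have mf : measurable_fun setT f by apply/measurable_EFinP; exact: measurable_int intf.
have mg : measurable_fun setT g by apply/measurable_EFinP; exact: measurable_int intg.
have mN : measurable N.
  by rewrite -[N]setTI; apply: (measurable_fun_ltr mg mf measurableT).
apply/eqP; rewrite -/N eq_le measure_ge0 andbT leNgt; apply/negP => N0.
have iN (h : T -> R) : U.-integrable setT (EFin \o h) -> U.-integrable N (EFin \o h).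
  by apply: integrableS.
have ifg : U.-integrable N (EFin \o (fun x => f x - g x)).
  exact: (integrableB mN (iN _ intf) (iN _ intg)).
pose k := (fun x => f x - g x) \_ N.
have ik : U.-integrable setT (EFin \o k).
  by rewrite /k -restrict_EFin; exact: ((integrable_mkcond _ mN).1 ifg).
have kE x : N x -> k x = f x - g x by move=> Nx; rewrite /k /patch mem_set.
have : (0 < \int[U]_x (k x)%:E)%E.
  apply: (@integral_gt0_on _ _ R U k N) => //.
    move=> x; have [Nx|Nx] := pselect (N x); last by rewrite /k /patch memNset.
    by rewrite kE// subr_ge0 ltW.
  by move=> x Nx; rewrite kE// subr_gt0.
have -> : (\int[U]_x (k x)%:E =
    \int[U]_(x in N) (f x)%:E - \int[U]_(x in N) (g x)%:E)%E.
  rewrite -(integralB mN (iN _ intf) (iN _ intg)) [RHS]integral_mkcond.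
  by apply: eq_integral => x _; rewrite /k /patch; case: ifP.
by rewrite sube_gt0 ltNge fg.
Qed.

(** A Radon-Nikodym density of [m] exceeds 1 only on a null set, by [density_le] against the
    constant 1. Truncating it at 1 keeps it a density and makes the bounds hold everywhere. *)
Lemma bounded_density d (T : measurableType d) (R : realType)
    (U : probability T R) (m : {measure set T -> \bar R}) :
  (forall A, measurable A -> (m A <= U A)%E) ->
  exists f : T -> R, [/\ measurable_fun setT f, forall x, 0 <= f x <= 1 &
    forall A, measurable A -> m A = (\int[U]_(x in A) (f x)%:E)%E].
Proof.
move=> mU.
have finm : fin_num_fun m.
  move=> A mA; rewrite ge0_fin_numE// (le_lt_trans (mU _ mA))//.
  by rewrite (le_lt_trans (probability_le1 _ _))// ltry.
have sfm : sigma_finite setT m.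
  by apply: fin_num_fun_sigma_finite; [rewrite measure0|exact: finm].
pose m' : {finite_measure set T -> \bar R} :=
  HB.pack_for (FiniteMeasure.type T R) (Measure.sort m)
    (isSFinite.Build _ _ _ (Measure.sort m) (sfinite_measure_sigma_finite sfm))
    (isSigmaFinite.Build _ _ _ (Measure.sort m) sfm)
    (isFinite.Build _ _ _ (Measure.sort m) finm).
have dom : m' `<< U.
  apply/null_content_dominatesP => A mA UA; apply/eqP.
  by rewrite eq_le measure_ge0 andbT -UA mU.
have [f0 [f00 f0fin intf0 mE]] := radon_nikodym_sigma_finite dom.
pose f1 := fine \o f0.
have f1E : EFin \o f1 = f0 by apply/funext => x /=; rewrite fineK.
have mf1 : measurable_fun setT f1.
  by apply/measurable_EFinP; rewrite f1E; exact: measurable_int intf0.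
have f1le : U [set x | 1 < f1 x] = 0%E.
  apply: (@density_le _ _ R U f1 (cst 1)).
  - by rewrite f1E.
  - apply: measurable_bounded_integrable => //.
      by apply: (@le_lt_trans _ _ 1%E); [exact: probability_le1|exact: ltry].
    by exists 1; split => // x x1 y _ /=; rewrite normr1 ltW.
  - move=> A mA; rewrite [leLHS](_ : _ = m A); last first.
      by rewrite [RHS]mE//; apply: eq_integral => x _; rewrite -f1E.
    have e : (\int[U]_(x in A) (cst (1%R : R) x)%:E = U A)%E.
      by apply: etrans (integral_cst U mA (1%R : R)%:E) _; exact: mul1e.
    by rewrite [leRHS]e mU.
exists (fun x => Num.min (f1 x) 1); split.
- exact: measurable_minr.
- by move=> x; rewrite le_min ler01 ge_min lexx orbT fine_ge0.
- move=> A mA; rewrite [LHS](mE A mA); apply: ae_eq_integral => //.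
  + by apply: measurable_funTS; exact: measurable_int intf0.
  + by apply/measurable_EFinP/measurable_funTS; exact: measurable_minr.
  + exists [set x | 1 < f1 x]; split => //.
      rewrite -[X in measurable X]setTI.
      exact: (measurable_fun_ltr (measurable_cst _) mf1 measurableT).
    move=> x /= /not_implyP[_]; rewrite -f1E /= => neq.
    by rewrite ltNge; apply/negP => le1; apply: neq; rewrite min_l.
Qed.

(** This is the distribution function of the uniform law on [0, 1]. Composing a copula with it also
    extends the copula beyond the square, as cumulative functions live on the whole line. *)
Definition clamp01 (R : realType) (x : R) : R := Num.max 0 (Num.min x 1).

Lemma clamp01E (R : realType) (x : R) :
  clamp01 R x = if x <= 0 then 0 else if x <= 1 then x else 1.
Proof.
rewrite /clamp01; case: (lerP x 1) => h1; last first.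
  by rewrite (max_r ler01) ifN// -ltNge; lra.
by case: (lerP x 0).
Qed.

Lemma clamp01_itv (R : realType) (x : R) : 0 <= clamp01 R x <= 1.
Proof. by rewrite clamp01E; case: (lerP x 0) => ?; case: (lerP x 1) => ?; lra. Qed.

Lemma clamp01_id (R : realType) (x : R) : 0 <= x <= 1 -> clamp01 R x = x.
Proof.
by rewrite clamp01E; case: (lerP x 0) => ?; case: (lerP x 1) => ? /andP[? ?]; lra.
Qed.

Lemma clamp01_lipschitz (R : realType) (a b : R) : a <= b ->
  0 <= clamp01 R b - clamp01 R a <= b - a.
Proof.
rewrite !clamp01E => ab.
by case: (lerP a 0) => ?; case: (lerP a 1) => ?; case: (lerP b 0) => ?;
  case: (lerP b 1) => ?; apply/andP; split; lra.
Qed.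

(** The function [u] is returned along with [U] so that [U] can be compared with other Stieltjes
    measures by [stieltjes_le]. *)
Lemma exists_uniform (R : realType) :
  exists (U : probability (measurableTypeR R) R) (u : cumulative R R),
  (forall x, u x = clamp01 R x) /\ forall A, U A = lebesgue_stieltjes_measure u A.
Proof.
have [u uE] := @lipschitz_cumulative R (clamp01 R) (@clamp01_lipschitz R).
have uNy : u @ -oo --> (0 : R).
  apply: cvg_near_cst; near=> x; rewrite uE clamp01E.
  have x0 : x <= 0 by near: x; exact: nbhs_ninfty_le.
  by case: (lerP x 0) => ?; case: (lerP x 1) => ?; lra.
have uy : u @ +oo --> (1 : R).
  apply: cvg_near_cst; near=> x; rewrite uE clamp01E.
  have x0 : 1 <= x by near: x; exact: nbhs_pinfty_ge.
  by case: (lerP x 0) => ?; case: (lerP x 1) => ?; lra.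
pose ub : cumulativeBounded (0 : R) (1 : R) :=
  HB.pack_for (CumulativeBounded.type (0 : R) (1 : R)) (Cumulative.sort u)
    (isCumulativeBounded.Build R 0 1 (Cumulative.sort u) uNy uy).
by exists (lebesgue_stieltjes_measure ub), u; split.
Unshelve. all: by end_near. Qed.

(** * Increments of a copula and construction of the induced measure *)

Lemma copula_lipschitz_y (R : realType) (C : R -> R -> R) : is_copula C ->
  forall x y s : R, 0 <= x <= 1 -> 0 <= y -> y <= s -> s <= 1 ->
  C x s <= C x y + (s - y).
Proof.
move=> hC x y s x01 y0 ys s1.
have := @copula_2incr _ _ hC x 1 y s; rewrite !(copula_1y hC); [|lra..].
have e : (1 : R) <= 1 by [].
by move=> /(_ _ _ e y0 ys s1); lra.
Qed.

(** These are the masses of the rectangles over [a, b] with heights [0, y] and [y, s]. They make the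
    Stieltjes measure of [C (., y)] well defined and increasing in [y]. *)
Lemma copula_incr_mono (R : realType) (C : R -> R -> R) : is_copula C ->
  forall a b y s : R, 0 <= a -> a <= b -> b <= 1 -> 0 <= y -> y <= s -> s <= 1 ->
  0 <= C b y - C a y /\ C b y - C a y <= C b s - C a s.
Proof.
move=> hC a b y s a0 ab b1 y0 ys s1; split.
  have := @copula_2incr _ _ hC a b 0 y; rewrite !(copula_x0 hC); [|lra..].
  have e : (0 : R) <= 0 by [].
  by move=> /(_ a0 ab b1 e y0 (le_trans ys s1)); lra.
by have := @copula_2incr _ _ hC a b y s a0 ab b1 y0 ys s1; lra.
Qed.

Lemma xsection_product d1 d2 (T1 : measurableType d1) (T2 : measurableType d2)
    (R : realType) (U : probability T1 R) (V : probability T2 R)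
    (A : set T1) (X : set (T1 * T2)) (f : T1 -> R) :
  (forall u, V (xsection X u) = (f u)%:E) ->
  (U \x V)%E ((A `*` setT) `&` X) = (\int[U]_(u in A) (f u)%:E)%E.
Proof.
move=> VX.
transitivity (\int[U]_u (V \o xsection ((A `*` setT) `&` X)) u)%E; first by [].
rewrite [RHS]integral_mkcond; apply: eq_integral => u _; rewrite /patch /=.
case: ifPn => uA.
  rewrite -VX; congr (V _); apply/seteqP; split => v; rewrite /xsection/= !inE.
    by case.
  by split => //; split => //; exact: set_mem.
rewrite (_ : xsection _ _ = set0) ?measure0//.
apply/seteqP; split => v //; rewrite /xsection/= inE => -[[]/= uA' _ _].
by move/negP: uA; apply; exact: mem_set.
Qed.

Lemma exists_induced (R : realType) (C : R -> R -> R) : is_copula C ->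
  exists m : probability (measurableTypeR R * measurableTypeR R)%type R,
  induces C m.
Proof.
move=> hC.
pose c := clamp01 R.
have c01 x : 0 <= c x <= 1 by exact: clamp01_itv.
have cid x : 0 <= x <= 1 -> c x = x by exact: clamp01_id.
have cmono a b : a <= b -> c a <= c b by move=> /(@clamp01_lipschitz R); rewrite -/c; lra.
have [U [u [uE UE]]] := exists_uniform R.
have gmono a b y s : a <= b -> y <= s ->
    0 <= C (c b) (c y) - C (c a) (c y) /\
    C (c b) (c y) - C (c a) (c y) <= C (c b) (c s) - C (c a) (c s).
  move=> /cmono ab /cmono ys; have := c01 a; have := c01 b; have := c01 y.
  by have := c01 s => *; apply: copula_incr_mono => //; lra.
(* Raising the height to 1, where [C x 1 = x], gives domination by the uniform law. *)
have gu a b y : a <= b -> C (c b) (c y) - C (c a) (c y) <= c b - c a.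
  move=> /cmono ab; have := c01 a; have := c01 b; have := c01 y => *.
  have := @copula_incr_mono _ _ hC (c a) (c b) (c y) 1.
  rewrite !(copula_x1 hC)//; case=> //; lra.
have /choice[G GE] : forall y, exists g : cumulative R R,
    forall x, g x = C (c x) (c y).
  move=> y; apply: lipschitz_cumulative => a b ab.
  have [h _] := gmono a b y y ab (lexx y); have := gu a b y ab.
  by have := @clamp01_lipschitz R a b ab; rewrite -/c; lra.
pose m y := lebesgue_stieltjes_measure (G y).
have mU y A : measurable A -> (m y A <= U A)%E.
  by move=> mA; rewrite UE; apply: stieltjes_le => // a b ab; rewrite !GE !uE; exact: gu.
have mm y s A : y <= s -> measurable A -> (m y A <= m s A)%E.
  move=> ys mA; apply: stieltjes_le => // a b ab; rewrite !GE.
  by have [] := gmono a b y s ab ys.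
have /choice[f fP] := fun y => bounded_density _ _ _ U (m y) (mU y).
have mf y : measurable_fun setT (f y) by have [] := fP y.
have f01 y x : 0 <= f y x <= 1 by have [_ /(_ x)] := fP y.
have mE y A : measurable A -> m y A = (\int[U]_(x in A) (f y x)%:E)%E.
  by have [_ _] := fP y; exact.
pose T := measurableTypeR R.
pose P : probability (T * T)%type R := (U \x U)%E.
(* The region under the graph of [f y]: its part above [A] has mass the integral of [f y] over [A],
   that is [m y A]. Excluding height 0 makes the sections half-open intervals. *)
pose E y : set (T * T) := [set w | 0 < w.2] `&` [set w | w.2 <= f y w.1].
have mw2 : measurable_fun setT (fun w : T * T => w.2 : R) by exact: measurable_snd.
have mfw y : measurable_fun setT (fun w : T * T => f y w.1).
  exact: (measurableT_comp (mf y) measurable_fst).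
have mEset y : measurable (E y).
  apply: measurableI; rewrite -[X in measurable X]setTI.
    exact: (measurable_fun_ltr (measurable_cst _) mw2 measurableT).
  exact: (measurable_fun_ler mw2 (mfw y) measurableT).
have PE y A : measurable A -> P ((A `*` setT) `&` E y) = m y A.
  move=> mA; rewrite mE//; apply: xsection_product => x.
  have -> : xsection (E y) x = `]0, f y x]%classic.
    by apply/seteqP; split => v; rewrite /xsection/= inE in_itv/=; [case=> -> ->|move/andP].
  have := f01 y x => fyx.
  rewrite UE stieltjes_itv ?uE -?/c; last lra.
  by rewrite !cid ?subr0//; lra.
(* The exceptional null set depends on the pair of heights, which is why only countably many heights
   enter the infimum below. *)
have fmono y s : y <= s -> U [set x | f s x < f y x] = 0%E.
  move=> ys; have bint t : U.-integrable setT (EFin \o f t).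
    apply: measurable_bounded_integrable => //.
      by apply: (@le_lt_trans _ _ 1%E); [exact: probability_le1|exact: ltry].
    exists 1; split => // b b1 x _ /=; have := f01 t x => ftx.
    by rewrite ger0_norm; lra.
  by apply: density_le => // A mA; rewrite -!mE//; exact: mm.
have PT A : measurable A -> P (A `*` setT) = U A.
  by move=> mA; apply: etrans (product_measure1E U U mA measurableT) _;
    apply: etrans (congr1 (mule (U A)) (probability_setT U)) _; exact: mule1.
(* An enumeration of the rationals clamped to [0, 1]; indices that encode no rational give 0. *)
pose q n : R := c (ratr (odflt 0%R (unpickle n : option rat))).
(* The default 1 stands for an unmet condition: it is never below a level [s <= 1], so it does not
   affect the events [Y w < s] used below. *)
pose Y_ n (w : T * T) : R :=
  if (0 < w.2) && (w.2 <= f (q n) w.1) then q n else 1.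
have q01 n : 0 <= q n <= 1 by exact: c01.
have Y01 n w : 0 <= Y_ n w by rewrite /Y_; case: ifP => // _; have := q01 n; lra.
have mY_ n : measurable_fun setT (Y_ n).
  apply: measurable_fun_ifT => //; apply: measurable_and.
    exact: measurable_fun_ltr.
  exact: measurable_fun_ler.
have Ylb w : has_lbound (range (Y_ ^~ w)) by exists 0 => _ [n _ <-]; exact: Y01.
pose Y (w : T * T) : R := infs (Y_ ^~ w) 0%N.
have mY : measurable_fun setT Y.
  by apply: measurable_fun_infs => // w _; exact: Ylb.
have Ylt s w : Y w < s <-> exists n, Y_ n w < s.
  have := @infs_preimage R _ setT s Y_ 0%N (fun t _ => Ylb t).
  move=> /seteqP[h1 h2]; split=> [Yw|[n Yn]].
    have [_ [n _ Yn]] : (setT `&` \bigcup_(k in [set k | (0 <= k)%N]) Y_ k @^-1` `]-oo, s[) w.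
      by apply: h1; split => //=; rewrite in_itv.
    by exists n; rewrite /= in_itv/= in Yn.
  have [_] : (setT `&` (fun x => infs (Y_^~ x) 0%N) @^-1` `]-oo, s[) w.
    by apply: h2; split => //; exists n => //=; rewrite in_itv.
  by rewrite /= in_itv.
have Y0 w : 0 <= Y w by rewrite leNgt; apply/negP => /Ylt[n]; rewrite ltNge Y01.
have mYlt s : measurable [set w | Y w < s].
  rewrite -[X in measurable X]setTI.
  exact: (measurable_fun_ltr mY (measurable_cst s) measurableT).
have mAT (A : set T) : measurable A -> measurable (A `*` [set: T]).
  by move=> mA; exact: measurableX.
have up (s : R) (A : set T) : 0 <= s <= 1 -> measurable A ->
    (P ((A `*` setT) `&` [set w | (Y w < s)%R]) <= m s A)%E.
  move=> s01 mA; rewrite -PE//.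
  (* If [Y w < s], then [w] lies under some [f (q n)] with [q n < s], hence under [f s] unless
     monotonicity fails between these two heights. [N] collects the countably many failures. *)
  pose N := \bigcup_n (if q n < s then [set x | f s x < f (q n) x] `*` [set: T] else set0).
  have mlt n : measurable [set x | f s x < f (q n) x].
    rewrite -[X in measurable X]setTI.
    exact: (measurable_fun_ltr (mf s) (mf (q n)) measurableT).
  have mNn n : measurable (if q n < s then [set x | f s x < f (q n) x] `*` [set: T] else set0).
    by case: ifP => // _; exact: mAT.
  have mN : measurable N by apply: bigcupT_measurable.
  have N0 : P N = 0%E.
    have Pnull n : P (if q n < s then [set x | f s x < f (q n) x] `*` [set: T] else set0) = 0%E.
      case: ifP => [/ltW/fmono lt0|_]; last exact: measure0.
      by apply: etrans (PT _ (mlt n)) lt0.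
    have nN : P.-negligible N.
      apply: negligible_bigcup => n; exists (if q n < s then
        [set x | f s x < f (q n) x] `*` [set: T] else set0).
      by split; [exact: mNn|exact: Pnull|exact: subset_refl].
    have [N' [mN' N'0 NN']] := nN.
    apply/eqP; rewrite eq_le measure_ge0 andbT -N'0.
    by apply: le_measure; rewrite ?inE.
  have sub : (A `*` setT) `&` [set w | Y w < s] `<=`
      ((A `*` setT) `&` E s) `|` N.
    move=> w [Aw /Ylt[n]]; rewrite /Y_; case: ifP; last by lra.
    move=> /andP[w0 wf] qs; have [fw|fw] := leP w.2 (f s w.1); first by left.
    right; exists n => //; rewrite qs; split => //=; exact: lt_le_trans wf.
  have mAE : measurable ((A `*` setT) `&` E s) by apply: measurableI => //; exact: mAT.
  have mAY : measurable ((A `*` setT) `&` [set w | Y w < s]).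
    by apply: measurableI => //; exact: mAT.
  apply: (@le_trans _ _ (P (((A `*` setT) `&` E s) `|` N))).
    by apply: le_measure; rewrite ?inE//; exact: measurableU.
  by apply: (le_trans (measureU2 _ mAE mN)); rewrite [X in (_ + X)%E]N0 adde0.
have lo n (s : R) (A : set T) : q n < s -> measurable A ->
    (m (q n) A <= P ((A `*` setT) `&` [set w | (Y w < s)%R]))%E.
  move=> qs mA; rewrite -PE//; apply: le_measure; rewrite ?inE//.
  - by apply: measurableI => //; exact: mAT.
  - by apply: measurableI => //; exact: mAT.
  - move=> w [Aw [w0 wf]]; split => //=; apply/Ylt; exists n.
    by rewrite /Y_ w0 wf.
pose XY (w : T * T) : T * T := (w.1, Y w).
have mXY : measurable_fun setT XY.
  by apply: measurable_fun_pair; [exact: measurable_fst|exact: mY].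
pose M : probability (T * T)%type R := distribution P (mfun_Sub (mem_set mXY)).
(* The closed interval is squeezed between []0, x]] and []-1, x]], which have the same mass because
   the clamped copula vanishes to the left of 0. *)
have mS s x : 0 <= s <= 1 -> 0 <= x <= 1 -> m s `[0, x]%classic = (C x s)%:E.
  move=> s01 x01.
  have half a : -1 <= a <= 0 -> m s `]a, x]%classic = (C x s)%:E.
    move=> a01; rewrite /m stieltjes_itv; last lra.
    rewrite !GE (cid x)// (cid s)// (_ : c a = 0); first by rewrite (copula_0y hC)// subr0.
    by rewrite /c clamp01E ifT//; lra.
  apply/eqP; rewrite eq_le -{1}(half (-1)); last lra.
  rewrite -(half 0); last lra.
  by apply/andP; split; apply: le_measure; rewrite ?inE// => z /=; rewrite !in_itv/=; lra.
have cdf x y : 0 <= x <= 1 -> 0 <= y <= 1 ->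
    M (`[0, x] `*` `[0, y]) = (C x y)%:E.
  move=> x01 y01.
  pose I0 : set T := `[0, x]%classic.
  have ME : M (`[0, x] `*` `[0, y]) =
      P ((I0 `*` setT) `&` [set w | Y w <= y]).
    congr (P _); apply/seteqP; split => w; rewrite /I0 /= !in_itv/= ?Y0.
      by case=> h1 h2.
    by case=> -[h1 _] h2.
  have mY' : measurable [set w | Y w <= y].
    rewrite -[X in measurable X]setTI.
    exact: (measurable_fun_ler mY (measurable_cst y) measurableT).
  have mI : measurable I0 by exact: measurable_itv.
  have mAY (s : R) : measurable (I0 `*` setT `&` [set w | Y w < s]).
    exact: (measurableI _ _ (mAT _ mI) (mYlt s)).
  have mAY' : measurable (I0 `*` setT `&` [set w | Y w <= y]).
    exact: (measurableI _ _ (mAT _ mI) mY').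
  (* The event [Y <= y] is compared with [Y < s] for [s] just above [y], and with the region of a
     rational height just below [y]; the Lipschitz bound controls the error by [e]. The heights 1
     and 0 leave no room on one side and are settled by the boundary values of [C]. *)
  apply/eqP; rewrite eq_le ME; apply/andP; split; apply/lee_addgt0Pr => e e0.
    have [y1|y1] := eqVneq y 1.
      apply: (@le_trans _ _ (P (I0 `*` setT))).
        by apply: le_measure; rewrite ?inE//; exact: (mAT _ mI).
      rewrite [leLHS](PT _ mI) y1 (copula_x1 hC)//.
      apply: (@le_trans _ _ (U `](-1), x]%classic)).
        by apply: le_measure; rewrite ?inE// => z; rewrite /I0 /= !in_itv/=; lra.
      rewrite UE stieltjes_itv; last lra.
      by rewrite -EFinD lee_fin !uE (clamp01_id _ _ x01) (clamp01E R (-1)) ifT; lra.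
    pose s := Num.min (y + e) 1.
    have [ys s1 se] : [/\ y < s, s <= 1 & s <= y + e].
      by rewrite /s; case: (lerP (y + e) 1) => h; split; lra.
    apply: (@le_trans _ _ (m s `[0, x]%classic)).
      apply: le_trans (up s _ _ mI); last lra.
      apply: le_measure; [rewrite inE; exact: mAY'|rewrite inE; exact: mAY|move=> w [? /= Yw]; split => //=; lra].
    rewrite mS//; last lra.
    rewrite -EFinD lee_fin.
    by have := @copula_lipschitz_y _ _ hC x y s x01; lra.
  have [y0|y0] := eqVneq y 0.
    by rewrite y0 (copula_x0 hC)// adde_ge0// lee_fin ltW.
  have /rat_in_itvoo[r] : Num.max 0 (y - e) < y.
    by rewrite gt_max; apply/andP; split; lra.
  rewrite in_itv/= gt_max => /andP[/andP[r0 ry] ry'].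
  have qE : q (pickle r) = ratr r by rewrite /q pickleK/= cid//; lra.
  apply: (@le_trans _ _ (m (q (pickle r)) `[0%R, x]%classic + e%:E)%E).
    rewrite mS// -EFinD lee_fin qE.
    by have := @copula_lipschitz_y _ _ hC x (ratr r) y x01; lra.
  apply: leeD => //; apply: (le_trans (lo _ y _ _ _)) => //; first by rewrite qE.
  by apply: le_measure; [rewrite inE; exact: mAY|rewrite inE; exact: mAY'|move=> w [? /= Yw]; split => //=; exact: ltW].
exists M.
have M1 (x : R) : 0 <= x <= 1 -> M (`[0, x] `*` `[0, 1]) = x%:E.
  by move=> x01; rewrite cdf ?(copula_x1 hC)//; lra.
have M2 (y : R) : 0 <= y <= 1 -> M (`[0, 1] `*` `[0, y]) = y%:E.
  by move=> y01; rewrite cdf ?(copula_1y hC)//; lra.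
have [_ ind] := copula_of_uniform_marginals _ M M1 M2.
move=> a b k d a0 ab b1 k0 kd d1.
by rewrite (ind a b k d)// !cdf//=; lra.
Qed.

(** * Optimality on a strip *)

(** Reduces the strip of negative mixed derivative to the positive case for [- G]. *)
Lemma has_partial_xyN (R : realType) (G : R -> R -> R) (p q : R) :
  has_partial_xy G p q ->
  has_partial_xy (fun x y => - G x y) p q /\
  forall x y, p < x < q -> 0 < y < 1 ->
    partial_xy (fun x y => - G x y) x y = - partial_xy G x y.
Proof.
move=> dG.
have pyN x y : p < x < q -> 0 < y < 1 ->
    partial_y (fun x y => - G x y) x y = - partial_y G x y.
  move=> xpq y01; have [dy _] := dG x y xpq y01.
  by rewrite /partial_y !derive1E deriveN.
have near_py x y : p < x < q -> 0 < y < 1 ->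
    {near x, (fun s => - partial_y G s y) =1
             (fun s => partial_y (fun x y => - G x y) s y)}.
  move=> xpq y01; have : \forall s \near x, s \in `]p, q[.
    by apply: near_in_itvoo; rewrite in_itv.
  by apply: filterS => s; rewrite in_itv/= => spq; rewrite pyN.
split=> x y xpq y01; have [dy dx] := dG x y xpq y01.
  split; first exact: derivableN.
  by apply: (@near_eq_derivable R R R _ _ x 1 (near_py x y xpq y01)); exact: derivableN.
rewrite /partial_xy !derive1E.
by rewrite -(@near_eq_derive R R R _ _ x 1 (near_py x y xpq y01)) deriveN.
Qed.

(** The exchange preserves marginals over the whole line, while copulas are described over [0, 1].
    This lemma and its mirror image translate between the two, since nothing is charged outside the
    full band. *)
Lemma probability_setX_full d1 d2 (T1 : measurableType d1)
    (T2 : measurableType d2) (R : realType)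
    (m : probability (T1 * T2)%type R) (U : set T1) (V : set T2) :
  measurable U -> measurable V -> m (setT `*` V) = 1%E ->
  m (U `*` V) = m (U `*` setT).
Proof.
move=> mU mV mTV.
have mX A B : measurable A -> measurable B -> measurable (A `*` B : set (T1 * T2)).
  by move=> *; exact: measurableX.
have mCV : measurable (~` V) by exact: measurableC.
have TCV : m (setT `*` ~` V) = 0%E.
  have -> : (setT `*` ~` V : set (T1 * T2)) = ~` (setT `*` V).
    by apply/seteqP; split => z /=; [case=> _ h [_]|move=> h; split=> // ?; apply: h].
  rewrite probability_setC; last exact: mX.
  by rewrite mTV subee.
have UCV : m (U `*` ~` V) = 0%E.
  apply/eqP; rewrite eq_le measure_ge0 andbT -TCV.
  by apply: le_measure; rewrite ?inE; [exact: mX|exact: mX|move=> z []].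
apply/eqP; rewrite eq_le; apply/andP; split.
  by apply: le_measure; rewrite ?inE; [exact: mX|exact: mX|move=> z []].
rewrite -[leRHS]adde0 -UCV.
apply: (le_trans _ (measureU2 _ (mX _ _ mU mV) (mX _ _ mU mCV))).
apply: le_measure; rewrite ?inE; [exact: mX|apply: measurableU; exact: mX|].
by move=> z [Uz _]; have [Vz|Vz] := pselect (V z.2); [left|right].
Qed.

Lemma probability_setX_full_l d1 d2 (T1 : measurableType d1)
    (T2 : measurableType d2) (R : realType)
    (m : probability (T1 * T2)%type R) (U : set T1) (V : set T2) :
  measurable U -> measurable V -> m (U `*` setT) = 1%E ->
  m (U `*` V) = m (setT `*` V).
Proof.
move=> mU mV mUT.
have mX A B : measurable A -> measurable B -> measurable (A `*` B : set (T1 * T2)).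
  by move=> *; exact: measurableX.
have mCU : measurable (~` U) by exact: measurableC.
have TCU : m (~` U `*` setT) = 0%E.
  have -> : (~` U `*` setT : set (T1 * T2)) = ~` (U `*` setT).
    by apply/seteqP; split => z /=; [case=> h _ [? _]|move=> h; split=> // ?; apply: h].
  rewrite probability_setC; last exact: mX.
  by rewrite mUT subee.
have CUV : m (~` U `*` V) = 0%E.
  apply/eqP; rewrite eq_le measure_ge0 andbT -TCU.
  by apply: le_measure; rewrite ?inE; [exact: mX|exact: mX|move=> z []].
apply/eqP; rewrite eq_le; apply/andP; split.
  by apply: le_measure; rewrite ?inE; [exact: mX|exact: mX|move=> z []].
rewrite -[leRHS]adde0 -CUV.
apply: (le_trans _ (measureU2 _ (mX _ _ mU mV) (mX _ _ mCU mV))).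
apply: le_measure; rewrite ?inE; [exact: mX|apply: measurableU; exact: mX|].
by move=> z [_ Vz]; have [Uz|Uz] := pselect (U z.1); [left|right].
Qed.

Lemma no_improving_exchange (R : realType) (F C : R -> R -> R)
    (m : probability (measurableTypeR R * measurableTypeR R)%type R)
    (A B : set (measurableTypeR R * measurableTypeR R)) :
  continuous_on_square F -> maximizes F C -> induces C m ->
  measurable A -> measurable B -> A `<=` @unit_square R -> B `<=` @unit_square R ->
  (0 < m A)%E -> (0 < m B)%E ->
  (forall z w, A z -> B w ->
    F z.1 z.2 + F w.1 w.2 < F z.1 w.2 + F w.1 z.2) -> False.
Proof.
move=> cF [hC maxC] iC mA mB AS BS A0 B0 FAB.
(* Extension by 0 makes the integrand bounded and measurable on the whole plane, as the exchange
   requires; the sets [A] and [B] stay inside the square, where [f] is [F]. *)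
pose f := (fun z => F z.1 z.2) \_ (@unit_square R).
have fE z : unit_square z -> f z = F z.1 z.2 by move=> zS; rewrite /f patchE mem_set.
have mS := @measurable_unit_square R.
have mf : measurable_fun setT f.
  by apply/(measurable_restrictT _ mS); exact: measurable_on_square.
have [M FM] := @bounded_on_square _ _ cF.
have fM z : `|f z| <= Num.max M 0.
  rewrite /f patchE; case: ifPn => [/set_mem/FM|_]; last by rewrite normr0 le_max lexx orbT.
  by move=> FzM; rewrite le_max FzM.
have intf (n : probability (measurableTypeR R * measurableTypeR R)%type R) :
    (\int[n]_(z in @unit_square R) (F z.1 z.2)%:E = \int[n]_z (f z)%:E)%E.
  rewrite integral_mkcond; apply: eq_integral => z _.
  by rewrite /f !patchE; case: ifP.
have fAB z w : A z -> B w -> f z + f w < f (z.1, w.2) + f (w.1, z.2).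
  move=> Az Bw; have [z1 z2] := AS z Az; have [w1 w2] := BS w Bw.
  by rewrite !fE//; exact: FAB.
have [m' [m'1 m'2]] := exchange_second _ _ _ _ _ _ _ _ _ _ mf fM mA mB A0 B0 fAB.
have I01 : measurable (`[0, 1] : set (measurableTypeR R)) by exact: measurable_itv.
have mI (x : R) : measurable (`[0, x] : set (measurableTypeR R)) by exact: measurable_itv.
have one : (0 : R) <= (1 : R) <= (1 : R) by rewrite ler01 lexx.
have zero : (0 : R) <= (0 : R) <= (1 : R) by rewrite ler01 lexx.
have mC (x y : R) : 0 <= x <= 1 -> 0 <= y <= 1 -> m (`[0, x] `*` `[0, y]) = (C x y)%:E.
  move=> /[dup] x01 /andP[x0 x1] /[dup] y01 /andP[y0 y1].
  rewrite (iC 0 x 0 y)// (copula_x0 hC x01) (copula_0y hC y01) (copula_x0 hC zero).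
  by rewrite !subr0 addr0.
have m11 : m (`[0, 1] `*` `[0, 1]) = 1%E by rewrite mC// (copula_x1 hC one).
have full1 : m (setT `*` `[0, 1]) = 1%E.
  apply/eqP; rewrite eq_le; apply/andP; split.
    by apply: probability_le1; exact: measurableX.
  by rewrite -[leLHS]m11; apply: le_measure; rewrite ?inE; [exact: measurableX..|move=> z []].
have full2 : m (`[0, 1] `*` setT) = 1%E.
  apply/eqP; rewrite eq_le; apply/andP; split.
    by apply: probability_le1; exact: measurableX.
  by rewrite -[leLHS]m11; apply: le_measure; rewrite ?inE; [exact: measurableX..|move=> z []].
have m1 (x : R) : 0 <= x <= 1 -> m' (`[0, x] `*` `[0, 1]) = x%:E.
  move=> x01; apply: etrans (probability_setX_full _ _ _ _ _ _ _ _ (mI x) I01 _) _.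
    by rewrite [LHS]m'2.
  rewrite [LHS]m'1// -[LHS](probability_setX_full _ _ _ _ _ _ _ _ (mI x) I01 full1).
  by rewrite mC// (copula_x1 hC x01).
have m2 (y : R) : 0 <= y <= 1 -> m' (`[0, 1] `*` `[0, y]) = y%:E.
  move=> y01; apply: etrans (probability_setX_full_l _ _ _ _ _ _ _ _ I01 (mI y) _) _.
    by rewrite [LHS]m'1.
  rewrite [LHS]m'2// -[LHS](probability_setX_full_l _ _ _ _ _ _ _ _ I01 (mI y) full2).
  by rewrite mC// (copula_1y hC y01).
have [cD iD] := copula_of_uniform_marginals _ m' m1 m2.
have := maxC _ cD _ _ iC iD; rewrite !intf => /le_lt_trans /[apply].
by rewrite ltxx.
Qed.

(** The left and bottom edges are degenerate rectangles, hence null. Half-open rectangles keep the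
    coordinates of points drawn from diagonally adjacent ones strictly ordered. *)
Lemma induces_oc (R : realType) (C : R -> R -> R)
    (m : probability (measurableTypeR R * measurableTypeR R)%type R) :
  induces C m -> forall a b c d : R,
  0 <= a -> a <= b -> b <= 1 -> 0 <= c -> c <= d -> d <= 1 ->
  0 < C b d - C b c - C a d + C a c -> (0 < m (`]a, b] `*` `]c, d]))%E.
Proof.
move=> iC a b c d a0 ab b1 c0 cd d1 pos.
have mX (i j : interval R) :
    measurable ([set` i] `*` [set` j] : set (measurableTypeR R * measurableTypeR R)).
  by apply: measurableX; exact: measurable_itv.
pose X : set (measurableTypeR R * measurableTypeR R) := `]a, b] `*` `]c, d].
pose Y : set (measurableTypeR R * measurableTypeR R) := `[a, a] `*` `[c, d].
pose Z : set (measurableTypeR R * measurableTypeR R) := `[a, b] `*` `[c, c].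
have sub : `[a, b] `*` `[c, d] `<=` X `|` Y `|` Z.
  move=> z [] /=; rewrite /X /Y /Z /setU /= !in_itv/= => z1 z2.
  have [az|az] := eqVneq z.1 a; first by left; right; split; lra.
  have [cz|cz] := eqVneq z.2 c; first by right; split; lra.
  by left; left; split; lra.
have [ma mc] : m (`[a, a] `*` `[c, d]) = 0%E /\ m (`[a, b] `*` `[c, c]) = 0%E.
  split; first rewrite (iC a a c d a0 (lexx a) (le_trans ab b1) c0 cd d1).
    by congr (_%:E); lra.
  by rewrite (iC a b c c a0 ab b1 c0 (lexx c) (le_trans cd d1)); congr (_%:E); lra.
apply: (@lt_le_trans _ _ (m (`[a, b] `*` `[c, d]))); first by rewrite (iC a b c d).
apply: (@le_trans _ _ (m (X `|` Y `|` Z))).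
  apply: le_measure; rewrite ?inE; [exact: mX| |exact: sub].
  by apply: measurableU; [apply: measurableU|]; exact: mX.
have le2 : (m (X `|` Y `|` Z) <= m (X `|` Y) + m Z)%E.
  by apply: measureU2; [apply: measurableU|]; exact: mX.
have le1 : (m (X `|` Y) <= m X + m Y)%E by apply: measureU2; exact: mX.
by move: le1 le2; rewrite [m Y]ma [m Z]mc !adde0 => le1 le2; exact: le_trans le1.
Qed.

Lemma oc_sub_unit_square (R : realType) (a b c d : R) :
  0 <= a -> b <= 1 -> 0 <= c -> d <= 1 ->
  `]a, b] `*` `]c, d] `<=` @unit_square R.
Proof.
by move=> a0 b1 c0 d1 z [] /=; rewrite !in_itv/= => *; split; rewrite /= in_itv/=; lra.
Qed.

(** The gaps between [C x y] and the two terms of the minimum are the masses of []p, x] * ]y, 1]]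
    and []x, q] * ]0, y]]. Both gaps are therefore nonnegative, and if both were positive,
    exchanging heights between these rectangles would improve the integral. *)
Lemma maximizer_supermodular_strip (R : realType) (F C : R -> R -> R) (p q : R) :
  0 <= p -> q <= 1 -> continuous_on_square F -> maximizes F C ->
  (forall a b c d : R, p <= a -> a < b -> b <= q -> 0 <= c -> c < d -> d <= 1 ->
    F a d + F b c < F a c + F b d) ->
  forall x y, p <= x <= q -> 0 <= y <= 1 ->
  C x y = Num.min (x - p + C p y) (C q y).
Proof.
move=> p0 q1 cF hmax Finc x y /andP[px xq] /andP[y0 y1].
have [hC _] := hmax; have [m iC] := exists_induced _ _ hC.
have x01 : 0 <= x <= 1 by lra.
have p01 : 0 <= p <= 1 by lra.
have q01 : 0 <= q <= 1 by lra.
have lexx0 : (0 : R) <= 0 by [].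
have lexx1 : (1 : R) <= 1 by [].
have mA := @copula_2incr _ _ hC p x y 1 p0 px (le_trans xq q1) y0 y1 lexx1.
have mB := @copula_2incr _ _ hC x q 0 y (le_trans p0 px) xq q1 lexx0 y0 y1.
have A0 := @induces_oc _ _ _ iC p x y 1 p0 px (le_trans xq q1) y0 y1 lexx1.
have B0 := @induces_oc _ _ _ iC x q 0 y (le_trans p0 px) xq q1 lexx0 y0 y1.
rewrite !(copula_x1 hC)// in mA A0; rewrite !(copula_x0 hC)// in mB B0.
apply/eqP; rewrite eq_le le_min; apply/andP; split; first by apply/andP; split; lra.
rewrite leNgt lt_min; apply/negP => /andP[C1 C2].
apply: (@no_improving_exchange _ _ _ _ (`]p, x] `*` `]y, 1]) (`]x, q] `*` `]0, y])
  cF hmax iC).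
- by apply: measurableX; exact: measurable_itv.
- by apply: measurableX; exact: measurable_itv.
- by apply: oc_sub_unit_square => //; lra.
- by apply: oc_sub_unit_square => //; lra.
- by apply: A0; lra.
- by apply: B0; lra.
- move=> z w [] /=; rewrite !in_itv/= => z1 z2 [w1 w2].
  by apply: Finc; lra.
Qed.

(** Here the relevant masses are those of []p, x] * ]0, y]] and []x, q] * ]y, 1]], equal to
    [C x y - C p y] and [C x y - (x + C q y - q)]. *)
Lemma maximizer_submodular_strip (R : realType) (F C : R -> R -> R) (p q : R) :
  0 <= p -> q <= 1 -> continuous_on_square F -> maximizes F C ->
  (forall a b c d : R, p <= a -> a < b -> b <= q -> 0 <= c -> c < d -> d <= 1 ->
    F a c + F b d < F a d + F b c) ->
  forall x y, p <= x <= q -> 0 <= y <= 1 ->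
  C x y = Num.max (x + C q y - q) (C p y).
Proof.
move=> p0 q1 cF hmax Fdec x y /andP[px xq] /andP[y0 y1].
have [hC _] := hmax; have [m iC] := exists_induced _ _ hC.
have x01 : 0 <= x <= 1 by lra.
have p01 : 0 <= p <= 1 by lra.
have q01 : 0 <= q <= 1 by lra.
have lexx0 : (0 : R) <= 0 by [].
have lexx1 : (1 : R) <= 1 by [].
have mA := @copula_2incr _ _ hC p x 0 y p0 px (le_trans xq q1) lexx0 y0 y1.
have mB := @copula_2incr _ _ hC x q y 1 (le_trans p0 px) xq q1 y0 y1 lexx1.
have A0 := @induces_oc _ _ _ iC p x 0 y p0 px (le_trans xq q1) lexx0 y0 y1.
have B0 := @induces_oc _ _ _ iC x q y 1 (le_trans p0 px) xq q1 y0 y1 lexx1.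
rewrite !(copula_x0 hC)// in mA A0; rewrite !(copula_x1 hC)// in mB B0.
apply/eqP; rewrite eq_le ge_max andbC; apply/andP; split; first by apply/andP; split; lra.
rewrite leNgt gt_max; apply/negP => /andP[C1 C2].
apply: (@no_improving_exchange _ _ _ _ (`]p, x] `*` `]0, y]) (`]x, q] `*` `]y, 1])
  cF hmax iC).
- by apply: measurableX; exact: measurable_itv.
- by apply: measurableX; exact: measurable_itv.
- by apply: oc_sub_unit_square => //; lra.
- by apply: oc_sub_unit_square => //; lra.
- by apply: A0; lra.
- by apply: B0; lra.
- move=> z w [] /=; rewrite !in_itv/= => z1 z2 [w1 w2].
  by apply: Fdec; lra.
Qed.

(** * The maximizer on the three strips *)

Theorem theorem3 (R : realType) (x1 x2 : R) (F F1 F2 F3 C : R -> R -> R)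
  (hx1 : 0 < x1) (hx12 : x1 < x2) (hx2 : x2 < 1)
  (hF : continuous_on_square F)
  (hF1 : forall x y : R, 0 < x < x1 -> 0 <= y <= 1 -> F x y = F1 x y)
  (hF2 : forall x y : R, x1 < x < x2 -> 0 <= y <= 1 -> F x y = F2 x y)
  (hF3 : forall x y : R, x2 < x < 1 -> 0 <= y <= 1 -> F x y = F3 x y)
  (hD1 : has_partial_xy F1 0 x1)
  (hD2 : has_partial_xy F2 x1 x2)
  (hD3 : has_partial_xy F3 x2 1)
  (hpos1 : forall x y : R, 0 < x < x1 -> 0 < y < 1 -> 0 < partial_xy F1 x y)
  (hneg2 : forall x y : R, x1 < x < x2 -> 0 < y < 1 -> partial_xy F2 x y < 0)
  (hpos3 : forall x y : R, x2 < x < 1 -> 0 < y < 1 -> 0 < partial_xy F3 x y)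
  (hmax : maximizes F C) :
  let h1 := fun y => C x1 y in
  let h2 := fun y => C x2 y in
  forall x y : R, 0 <= y <= 1 ->
    (0 <= x <= x1 -> C x y = Num.min x (h1 y)) /\
    (x1 <= x <= x2 -> C x y = Num.max (x + h2 y - x2) (h1 y)) /\
    (x2 <= x <= 1 -> C x y = Num.min (x - x2 + h2 y) y).
Proof.
have [hC _] := hmax.
move=> h1 h2 x y y01; split; [|split] => xI.
- have incF := strictly_2increasing _ F F1 0 x1 (lexx 0) hx1
    (ltW (lt_trans hx12 hx2)) hF hF1 hD1 hpos1.
  rewrite (maximizer_supermodular_strip _ F C 0 x1 (lexx 0)
    (ltW (lt_trans hx12 hx2)) hF hmax incF x y xI y01).
  by rewrite subr0 (copula_0y hC y01) addr0.
- have [dN dNE] := has_partial_xyN _ _ _ _ hD2.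
  have cN : continuous_on_square (fun x y => - F x y).
    by move=> z; apply: cvgN; exact: hF.
  have decF : forall a b c d : R, x1 <= a -> a < b -> b <= x2 ->
      0 <= c -> c < d -> d <= 1 -> F a c + F b d < F a d + F b c.
    move=> a b c d *.
    (* Strict 2-decrease of [F] on the middle strip is strict 2-increase of [- F]. *)
    suff : - F a d + - F b c < - F a c + - F b d by lra.
    apply: (strictly_2increasing _ (fun x y => - F x y) (fun x y => - F2 x y) x1 x2
      (ltW hx1) hx12 (ltW hx2) cN _ dN) => //.
    + by move=> s t sI tI; rewrite hF2.
    + by move=> s t sI tI; rewrite dNE// oppr_gt0 hneg2.
  exact: (maximizer_submodular_strip _ F C x1 x2 (ltW hx1) (ltW hx2) hF hmax decF
    x y xI y01).
- have incF := strictly_2increasing _ F F3 x2 1 (ltW (lt_trans hx1 hx12)) hx2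
    (lexx 1) hF hF3 hD3 hpos3.
  rewrite (maximizer_supermodular_strip _ F C x2 1 (ltW (lt_trans hx1 hx12))
    (lexx 1) hF hmax incF x y xI y01).
  by rewrite (copula_1y hC y01).
Qed.
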